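(* Let $f$ satisfy (RHS.1) and (RHS.2), and let $\chi$ satisfy (OBS.1) with respect to a given $g\in C(\partial\Omega)$. Let $w\in\mathrm{USC}(\overline\Omega)$ and $v\in\mathrm{LSC}(\overline\Omega)$ satisfy, in the viscosity sense, $\mathbb T[w;f,\chi]\le0\le\mathbb T[v;f,\chi]$ in $\Omega$. If $w\le v$ on $\partial\Omega$, then $w\le v$ in $\Omega$.
   Context: $\Omega\subset\mathbb R^d$ is a bounded domain with continuous boundary. (RHS.1) $f\in C(\Omega)\cap L^\infty(\Omega)$. (RHS.2) either $\sup_\Omega f<0$, or $\inf_\Omega f>0$, or $f\equiv0$. (OBS.1) $\chi\in C(\overline\Omega)$ and $\chi<g$ on $\partial\Omega$. For $\varphi\in C^2$: $\Delta^\diamond_\infty\varphi(x)=|D\varphi(x)|^{-2}D\varphi(x)^\intercal D^2\varphi(x)D\varphi(x)$ when $D\varphi(x)\ne0$; $\Delta^+_\infty\varphi(x)$ (resp. $\Delta^-_\infty\varphi(x)$) equals $\Delta^\diamond_\infty\varphi(x)$ if $D\varphi(x)\ne0$ and $\lambda_{\max}(D^2\varphi(x))$ (resp. $\lambda_{\min}(D^2\varphi(x))$) if $D\varphi(x)=0$. The obstacle operator is $\mathbb T[w;f,\chi](x)=\min\{-\Delta^\diamond_\infty w(x)-f(x),\,w(x)-\chi(x)\}$, interpreted in the viscosity sense: $w\in\mathrm{USC}(\overline\Omega)$ satisfies $\mathbb T[w;f,\chi]\le0$ in $\Omega$ if for every $x_0\in\Omega$ and $\varphi\in C^2$ such that $w-\varphi$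 has a local maximum at $x_0$, $\min\{-\Delta^+_\infty\varphi(x_0)-f(x_0),\,w(x_0)-\chi(x_0)\}\le0$; $v\in\mathrm{LSC}(\overline\Omega)$ satisfies $\mathbb T[v;f,\chi]\ge0$ if for every $x_0\in\Omega$ and $\varphi\in C^2$ such that $v-\varphi$ has a local minimum at $x_0$, $\min\{-\Delta^-_\infty\varphi(x_0)-f(x_0),\,v(x_0)-\chi(x_0)\}\ge0$. *)

(* Defs.v *)
From HB Require Import structures.
From mathcomp Require Import all_boot all_order all_algebra.
From mathcomp Require Import all_classical all_reals all_analysis.
Set Implicit Arguments. Unset Strict Implicit. Unset Printing Implicit Defensive.
Import Order.TTheory GRing.Theory Num.Theory.
Import numFieldNormedType.Exports.
Local Open Scope classical_set_scope.
Local Open Scope ring_scope.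

Section Defs.
Variables (R : realType) (d : nat).
Notation V := 'rV[R]_d.

Definition ebase (i : 'I_d) : V := delta_mx 0 i.

Definition pderiv (i : 'I_d) (f : V -> R) : V -> R := fun x => 'D_(ebase i) f x.

Definition C2 (f : V -> R) : Prop :=
  continuous f /\
  (forall i x, derivable f x (ebase i)) /\
  (forall i, continuous (pderiv i f)) /\
  (forall i j x, derivable (pderiv i f) x (ebase j)) /\
  (forall i j, continuous (pderiv j (pderiv i f))).

Definition grad (f : V -> R) (x : V) : V := \row_i pderiv i f x.
Definition hess (f : V -> R) (x : V) : 'M[R]_d :=
  \matrix_(i, j) pderiv j (pderiv i f) x.

Definition dotv (p q : V) : R := \sum_i p 0 i * q 0 i.
Definition sqnorm (p : V) : R := dotv p p.

Definition lambda_max (A : 'M[R]_d) : R := sup [set a : R | eigenvalue A a].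
Definition lambda_min (A : 'M[R]_d) : R := inf [set a : R | eigenvalue A a].

Definition inflap_diamond (p : V) (X : 'M[R]_d) : R :=
  (sqnorm p)^-1 * (p *m X *m p^T) 0 0.

Definition inflap_plus (f : V -> R) (x : V) : R :=
  if grad f x != 0 then inflap_diamond (grad f x) (hess f x)
  else lambda_max (hess f x).

Definition inflap_minus (f : V -> R) (x : V) : R :=
  if grad f x != 0 then inflap_diamond (grad f x) (hess f x)
  else lambda_min (hess f x).

Definition bdry (A : set V) : set V := closure A `\` interior A.

Definition bounded_domain (O : set V) : Prop :=
  O !=set0 /\ open O /\ connected O /\ bounded_set O.

(* continuous boundary: near each boundary point, O is (in a rotated frame
   with unit "vertical" direction nu) the strict epigraph of a continuous
   function gamma of the coordinates orthogonal to nu. *)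
Definition continuous_boundary (O : set V) : Prop :=
  forall x0, bdry O x0 ->
  exists (r : R) (nu : V) (gamma : V -> R),
    0 < r /\ sqnorm nu = 1 /\ continuous gamma /\
    (forall y, gamma y = gamma (y - dotv y nu *: nu)) /\
    forall x, ball x0 r x ->
      (O x <-> dotv x nu > gamma (x - dotv x nu *: nu)).

Definition usc_on (A : set V) (w : V -> R) : Prop :=
  forall x, A x -> forall eps : R, 0 < eps ->
    exists2 del : R, 0 < del & forall y, A y -> ball x del y -> w y < w x + eps.
Definition lsc_on (A : set V) (w : V -> R) : Prop :=
  forall x, A x -> forall eps : R, 0 < eps ->
    exists2 del : R, 0 < del & forall y, A y -> ball x del y -> w x - eps < w y.

Definition visc_sub (O : set V) (f chi w : V -> R) : Prop :=
  forall x0 (phi : V -> R), O x0 -> C2 phi ->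
    (\forall x \near x0, w x - phi x <= w x0 - phi x0) ->
    Num.min (- inflap_plus phi x0 - f x0) (w x0 - chi x0) <= 0.

Definition visc_super (O : set V) (f chi v : V -> R) : Prop :=
  forall x0 (phi : V -> R), O x0 -> C2 phi ->
    (\forall x \near x0, v x - phi x >= v x0 - phi x0) ->
    Num.min (- inflap_minus phi x0 - f x0) (v x0 - chi x0) >= 0.

Definition RHS1 (O : set V) (f : V -> R) : Prop :=
  {within O, continuous f} /\ exists M : R, forall x, O x -> `|f x| <= M.

Definition RHS2 (O : set V) (f : V -> R) : Prop :=
  (exists2 c : R, c < 0 & forall x, O x -> f x <= c) \/
  (exists2 c : R, 0 < c & forall x, O x -> c <= f x) \/
  (forall x, O x -> f x = 0).

Definition OBS1 (O : set V) (chi g : V -> R) : Prop :=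
  {within closure O, continuous chi} /\ forall x, bdry O x -> chi x < g x.

End Defs.

(* Main.v *)
(** A finite-difference argument in the style of Armstrong and Smart, which
    avoids the theorem on sums.  Comparison with the quadratic cones
    [c + a |y - x| - K/2 |y - x|^2] shows that a subsolution of
    [- Delta u <= k] satisfies
      [2 max_{B(x,e)} u <= max_{B(x,2e)} u + u x + e^2 k],
    and a supersolution the mirror inequality.  Where [w > v >= chi] the
    obstacle is inactive for [w]; since [w] is only upper semicontinuous, a
    first cone comparison is needed to see that it stays inactive on a whole
    ball around the relevant centres.

    If [w - v] had a positive interior value, one maximises [a w(y) - v(z)]
    over pairs with [|y - z| <= 2e], where [a = 1 + t], [1 - t] or [1] according
    as [f < 0], [f > 0] or [f = 0].  The boundary inequality makes these pairs
    accumulate, as [e -> 0], at an interior point.  Adding the two inequalities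
    at a point [m] with [y, z] in [B(m, e)] gives [0 <= (a - 1) f + o(1)], which
    is absurd when [f] does not vanish.  When [f = 0], equality forces [(m, m)]
    to be again a maximal pair with the same [w]-value; moving [m] in a
    coordinate direction contradicts an extremal choice of the pair. *)

Require Import Defs.
From HB Require Import structures.
From mathcomp Require Import all_boot all_order all_algebra.
From mathcomp Require Import all_classical all_reals all_analysis.
From mathcomp Require Import ring lra.
Import Order.TTheory GRing.Theory Num.Theory.
Import numFieldNormedType.Exports.
Local Open Scope classical_set_scope.
Local Open Scope ring_scope.

Set Implicit Arguments.
Unset Strict Implicit.
Unset Printing Implicit Defensive.

(** * Semicontinuous functions on compact sets *)

Section Semicontinuity.
Variables (R : realType) (T : topologicalType).
Implicit Types (A B : set T) (F : T -> R).

Definition usc_within A F := forall x, A x -> forall e : R, 0 < e ->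
  \forall y \near x, A y -> F y < F x + e.

Lemma usc_within_sub A B F : B `<=` A -> usc_within A F -> usc_within B F.
Proof.
move=> BA uF x Bx e e0; have := uF x (BA _ Bx) e e0.
by apply: filterS => y Fy By; apply: Fy; exact: BA.
Qed.

Lemma usc_withinD A F G : usc_within A F -> usc_within A G ->
  usc_within A (fun x => F x + G x).
Proof.
move=> uF uG x Ax e e0; have e2 : 0 < e / 2 by rewrite divr_gt0.
apply: filterS2 (uF x Ax _ e2) (uG x Ax _ e2) => y hF hG Ay.
by have := hF Ay; have := hG Ay; lra.
Qed.

Lemma usc_withinZ A F (a : R) : 0 < a -> usc_within A F ->
  usc_within A (fun x => a * F x).
Proof.
move=> a0 uF x Ax e e0; have := uF x Ax (e / a) (divr_gt0 e0 a0).
apply: filterS => y Fy Ay; have := Fy Ay.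
by rewrite -(ltr_pM2l a0) mulrDr mulrCA divff ?mulr1 // gt_eqF.
Qed.

Lemma continuous_usc A F : continuous F -> usc_within A F.
Proof.
move=> cF x _ e e0; have /cvgrPdist_lt /(_ e e0) := cF x.
by apply: filterS => y; rewrite ltr_norml => /andP[h1 h2] _; lra.
Qed.

(** At a cluster point with value below [c], semicontinuity would give a neighbourhood that misses
    the superlevel set. *)
Lemma compact_usc_superlevel A F c : compact A -> usc_within A F ->
  compact [set x | A x /\ c <= F x].
Proof.
move=> cA uF G PG GA.
have [|p [Ap clp]] := cA G PG; first by apply: filterS GA => y [].
exists p; split; last exact: clp.
split=> //; rewrite leNgt; apply/negP => Fpc.
have e0 : 0 < c - F p by lra.
have [y [[Ay cy] Fy]] := clp _ _ GA (uF p Ap _ e0).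
by have := Fy Ay; lra.
Qed.

Lemma usc_argmax A F : compact A -> A !=set0 -> usc_within A F ->
  exists2 p, A p & forall x, A x -> F x <= F p.
Proof.
move=> cA [a Aa] uF.
(* The sets [B b] are nested because values are totally ordered, so they generate a filter; each of
   its cluster points is a maximiser. *)
pose B (b : T) := [set x | A x /\ F b <= F x].
pose G := filter_from A B.
have fG : Filter G.
  apply: filter_from_filter; first by exists a.
  move=> i j Ai Aj; have [ij|ji] := leP (F i) (F j).
    by exists j => // x [Ax jx]; split; split=> //; apply: le_trans jx.
  by exists i => // x [Ax ix]; split; split=> //; apply: le_trans ix; exact: ltW.
have PG : ProperFilter G.
  by apply: filter_from_proper => // i Ai; exists i.
have [|p [Ap clp]] := cA G PG; first by exists a => // x [].
exists p => // x Ax; rewrite leNgt; apply/negP => Fpx.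
have e0 : 0 < F x - F p by lra.
have GB : G (B x) by exists x.
have [y [[Ay xy] Fy]] := clp _ _ GB (uF p Ap _ e0).
by have := Fy Ay; lra.
Qed.

(** Compactness of the set of maximisers allows a second function to be maximised over it, hence
    lexicographic maximisation. *)
Lemma usc_argmax_compact A F : compact A -> A !=set0 -> usc_within A F ->
  let E := [set p | A p /\ forall x, A x -> F x <= F p] in
  E !=set0 /\ compact E.
Proof.
move=> cA A0 uF E; have [p Ap pmax] := usc_argmax cA A0 uF.
split; first by exists p.
have -> : E = [set x | A x /\ F p <= F x].
  apply/seteqP; split => x /= [Ax xp]; split=> //; first exact: xp.
  by move=> y Ay; apply: le_trans xp; exact: pmax.
exact: compact_usc_superlevel.
Qed.

End Semicontinuity.

(** * Euclidean geometry of row vectors *)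

Section SquaredNorm.
Variables (R : realType) (d : nat).
Local Notation V := 'rV[R]_d.
Implicit Types (p q x y z : V).

Lemma sqnorm_ge0 p : 0 <= sqnorm p.
Proof. by apply: sumr_ge0 => i _; rewrite -expr2 sqr_ge0. Qed.

Lemma sqnorm0 : sqnorm (0 : V) = 0.
Proof. by rewrite /sqnorm /dotv big1 // => i _; rewrite mxE mulr0. Qed.

Lemma sqr_coord_le_sqnorm p i : p 0 i ^+ 2 <= sqnorm p.
Proof.
rewrite /sqnorm /dotv (bigD1 i) //= expr2 lerDl.
by apply: sumr_ge0 => j _; rewrite -expr2 sqr_ge0.
Qed.

Lemma sqnorm_eq0 p : (sqnorm p == 0) = (p == 0).
Proof.
apply/eqP/eqP => [p0|->]; last exact: sqnorm0.
apply/rowP => i; rewrite mxE; apply/eqP; rewrite -sqrf_eq0 eq_le sqr_ge0 andbT.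
by rewrite -p0 sqr_coord_le_sqnorm.
Qed.

Lemma sqnorm_gt0 p : (0 < sqnorm p) = (p != 0).
Proof. by rewrite lt_def sqnorm_ge0 andbT sqnorm_eq0. Qed.

Lemma sqnormZ (a : R) p : sqnorm (a *: p) = a ^+ 2 * sqnorm p.
Proof.
rewrite /sqnorm /dotv mulr_sumr; apply: eq_bigr => i _.
by rewrite mxE expr2; ring.
Qed.

Lemma sqnormN p : sqnorm (- p) = sqnorm p.
Proof. by rewrite -scaleN1r sqnormZ sqrrN expr1n mul1r. Qed.

Lemma sqnormBC p q : sqnorm (p - q) = sqnorm (q - p).
Proof. by rewrite -opprB sqnormN. Qed.

Lemma sqnormD_le p q : sqnorm (p + q) <= 2 * sqnorm p + 2 * sqnorm q.
Proof.
rewrite /sqnorm /dotv !mulr_sumr -big_split /=; apply: ler_sum => i _.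
rewrite !mxE -subr_ge0.
rewrite (_ : _ - _ = (p 0 i - q 0 i) ^+ 2) ?sqr_ge0 //; ring.
Qed.

Lemma sqnorm_dist_le x y z :
  sqnorm (x - z) <= 2 * sqnorm (x - y) + 2 * sqnorm (y - z).
Proof. by have := sqnormD_le (x - y) (y - z); rewrite addrA subrK. Qed.

Lemma dotv_cauchy p q : dotv p q ^+ 2 <= sqnorm p * sqnorm q.
Proof.
have [->|q0] := eqVneq q 0.
  rewrite sqnorm0 mulr0 (_ : dotv p 0 = 0) ?expr0n //.
  by rewrite /dotv big1 // => i _; rewrite mxE mulr0.
have q1 : 0 < sqnorm q by rewrite sqnorm_gt0.
have H t : 0 <= sqnorm p - 2 * t * dotv p q + t ^+ 2 * sqnorm q.
  rewrite (_ : _ + _ = sqnorm (p - t *: q)) ?sqnorm_ge0 //.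
  rewrite /sqnorm /dotv !mulr_sumr -sumrN -!big_split /=.
  by apply: eq_bigr => i _; rewrite !mxE; ring.
(* This value of [t] minimises the quadratic [H]. *)
have := H (dotv p q / sqnorm q); rewrite -(pmulr_lge0 _ q1) => h.
rewrite -subr_ge0; apply: (le_trans h); rewrite le_eqVlt; apply/orP; left.
by apply/eqP; field; rewrite gt_eqF.
Qed.

Lemma coord_continuous_rV (i : 'I_d) : continuous (fun y : V => y 0 i).
Proof. exact: coord_continuous. Qed.

Lemma continuous_sqdist x : continuous (fun y : V => sqnorm (y - x)).
Proof.
have ci i : continuous (fun y : V => (y 0 i - x 0 i) * (y 0 i - x 0 i)).
  have cB : continuous (fun y : V => y 0 i - x 0 i).
    by move=> y; apply: continuousB; [exact: coord_continuous_rV|exact: cst_continuous].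
  by move=> y; exact: (cvgM (cB y) (cB y)).
rewrite (_ : (fun _ => _) =
  fun y : V => \sum_i (y 0 i - x 0 i) * (y 0 i - x 0 i)); last first.
  by apply/funext => y; apply: eq_bigr => i _; rewrite !mxE.
by apply: continuous_big => [|i _]; [exact: add_continuous|exact: ci].
Qed.

Lemma near_sqdist x (e : R) : 0 < e -> \forall y \near x, sqnorm (y - x) < e.
Proof.
move=> e0; have /cvgrPdist_lt /(_ e e0) := @continuous_sqdist x x.
apply: filterS => y; rewrite subrr sqnorm0 sub0r normrN.
by rewrite ger0_norm ?sqnorm_ge0.
Qed.

(** Neighbourhoods come from sup-norm balls, and every coordinate is bounded by the Euclidean norm;
    halving the radius turns [<=] into [<]. *)
Lemma near_sqdistP x (P : set V) : (\forall y \near x, P y) ->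
  exists2 e : R, 0 < e & forall y, sqnorm (y - x) <= e ^+ 2 -> P y.
Proof.
move=> /nbhs_ballP[e /= e0 eP]; exists (e / 2); first by rewrite divr_gt0.
move=> y ye; apply: eP; split=> // i j; rewrite ord1 /ball /= distrC.
have : (y 0 j - x 0 j) ^+ 2 <= (e / 2) ^+ 2.
  by apply: le_trans ye; have := sqr_coord_le_sqnorm (y - x) j; rewrite !mxE.
have e2 : 0 < e / 2 by rewrite divr_gt0.
rewrite -[X in X <= _]real_normK ?num_real // ler_pXn2r // ?nnegrE ?(ltW e2) //.
by move=> h; apply: le_lt_trans h _; rewrite ltr_pdivrMr // ltr_pMr // ltr1n.
Qed.

(** Closed balls must be Euclidean rather than sup-norm ones: the infinity Laplacian is adapted to
    distance functions of the Euclidean norm. *)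
Definition eball x (r : R) : set V := [set y | sqnorm (y - x) <= r ^+ 2].

Lemma eball_center x r : eball x r x.
Proof. by rewrite /eball /= subrr sqnorm0 sqr_ge0. Qed.

Lemma compact_eball x r : compact (eball x r).
Proof.
pose A (i : 'I_d) := `[x 0 i - `|r|, x 0 i + `|r|]%classic.
have cA : compact [set v : V | forall i, A i (v ord0 i)].
  by apply: rV_compact => i; exact: segment_compact.
have cN : continuous (fun y : V => - sqnorm (y - x)).
  by move=> y; exact: (cvgN (@continuous_sqdist x y)).
have := @compact_usc_superlevel _ _ _ _ (- r ^+ 2) cA (continuous_usc cN).
congr (compact _); apply/seteqP; split => y /=.
  by case=> _; rewrite lerN2.
move=> yr; split; last by rewrite lerN2.
move=> i; rewrite /A /= in_itv /=.
have : (y 0 i - x 0 i) ^+ 2 <= r ^+ 2.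
  by apply: le_trans yr; have := sqr_coord_le_sqnorm (y - x) i; rewrite !mxE.
rewrite -[X in X <= _]real_normK ?num_real // -[X in _ <= X]real_normK ?num_real //.
rewrite ler_pXn2r // ?nnegrE // ler_norml => /andP[h1 h2].
by apply/andP; split; lra.
Qed.

End SquaredNorm.

(** * Radial quadratic test functions and their derivatives *)

Section TestFunctions.
Variables (R : realType) (d : nat).
Local Notation V := 'rV[R]_d.
Implicit Types (p q x y z : V) (psi : V -> R).

Lemma is_derive_coord y (v : V) (i : 'I_d) :
  is_derive y v (fun z : V => z 0 i) (v 0 i).
Proof.
apply: DeriveDef; first exact/diff_derivable/differentiable_coord.
apply: lim_near_cst => //; apply: filterS (nbhs_dnbhs_neq (0 : R)) => h h0.
by rewrite /= !mxE addrK /GRing.scale /= mulrA mulVf ?mul1r.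
Qed.

Lemma is_derive_coordB x y (i j : 'I_d) :
  is_derive y (ebase R j) (fun z : V => z 0 i - x 0 i) (i == j)%:R.
Proof.
have h1 := is_derive_coord y (ebase R j) i.
have h2 : is_derive y (ebase R j) (fun z : V => z 0 i - x 0 i)
    (ebase R j 0 i - 0) by exact: is_deriveB.
by apply: is_derive_eq h2 _; rewrite subr0 mxE eqxx.
Qed.

Lemma is_derive_sqdist x y (j : 'I_d) :
  is_derive y (ebase R j) (fun z => sqnorm (z - x)) (2 * (y 0 j - x 0 j)).
Proof.
pose c (i : 'I_d) := fun z : V => z 0 i - x 0 i.
have -> : (fun z => sqnorm (z - x)) = \sum_i (c i * c i).
  apply/funext => z; rewrite fct_sumE; apply: eq_bigr => i _.
  by rewrite !mxE.
have h i : is_derive y (ebase R j) (c i * c i)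
    (c i y *: (i == j)%:R + c i y *: (i == j)%:R).
  by have := is_derive_coordB x y i j => hi; exact: is_deriveM.
have hs := is_derive_sum h; apply: is_derive_eq hs _.
rewrite (bigD1 j) //= eqxx big1 => [|i /negbTE ->].
  by rewrite /c addr0 /GRing.scale /=; ring.
by rewrite scaler0 addr0.
Qed.

(** A second-order Taylor polynomial in the variable [|y - x|^2] around [s0]. Unlike a cone it is
    smooth at [x] too, so it is [C2] on the whole space. *)
Definition radial x (s0 b c : R) : V -> R :=
  fun y => b * (sqnorm (y - x) - s0) + c * (sqnorm (y - x) - s0) ^+ 2.

Variables (x : V) (s0 b c : R).
Local Notation psi0 := (radial x s0 b c).
Local Notation slope := (fun y : V => b + 2 * c * (sqnorm (y - x) - s0)).

Lemma is_derive_shifted_sqdist y (j : 'I_d) :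
  is_derive y (ebase R j) (fun z => sqnorm (z - x) - s0) (2 * (y 0 j - x 0 j)).
Proof.
have h1 := is_derive_sqdist x y j.
have h2 : is_derive y (ebase R j) (fun z => sqnorm (z - x) - s0)
    (2 * (y 0 j - x 0 j) - 0) by exact: is_deriveB.
by apply: is_derive_eq h2 _; rewrite subr0.
Qed.

Lemma is_derive_radial y (j : 'I_d) :
  is_derive y (ebase R j) psi0 (slope y * (2 * (y 0 j - x 0 j))).
Proof.
pose t := fun z : V => sqnorm (z - x) - s0.
have ht : is_derive y (ebase R j) t _ := is_derive_shifted_sqdist y j.
have -> : psi0 = b *: t + c *: (t * t).
  by apply/funext => z; rewrite /radial /t /= expr2.
have h := is_deriveD (is_deriveZ b ht) (is_deriveZ c (is_deriveM ht ht)).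
by apply: is_derive_eq h _; rewrite /GRing.scale /= /t; ring.
Qed.

Lemma pderiv_radial (j : 'I_d) :
  pderiv j psi0 = fun y => slope y * (2 * (y 0 j - x 0 j)).
Proof.
by apply/funext => y; rewrite /pderiv; have := is_derive_radial y j => h;
  rewrite derive_val.
Qed.

Lemma is_derive_pderiv_radial y (i j : 'I_d) :
  is_derive y (ebase R j) (pderiv i psi0)
    (2 * slope y * (i == j)%:R + 8 * c * (y 0 i - x 0 i) * (y 0 j - x 0 j)).
Proof.
pose t := fun z : V => sqnorm (z - x) - s0.
pose ci := fun z : V => z 0 i - x 0 i.
have ht : is_derive y (ebase R j) t _ := is_derive_shifted_sqdist y j.
have hc : is_derive y (ebase R j) ci _ := is_derive_coordB x y i j.
have -> : pderiv i psi0 = (2 * b) *: ci + (4 * c) *: (t * ci).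
  by rewrite pderiv_radial; apply/funext => z;
    rewrite !fctE /t /ci /GRing.scale /=; ring.
have h := is_deriveD (is_deriveZ (2 * b) hc) (is_deriveZ (4 * c) (is_deriveM ht hc)).
by apply: is_derive_eq h _; rewrite /GRing.scale /= /t /ci; ring.
Qed.

Lemma pderiv2_radial (i j : 'I_d) : pderiv j (pderiv i psi0) =
  fun y => 2 * slope y * (i == j)%:R + 8 * c * (y 0 i - x 0 i) * (y 0 j - x 0 j).
Proof.
by apply/funext => y; rewrite {1}/pderiv;
  have := is_derive_pderiv_radial y i j => h; rewrite derive_val.
Qed.

Lemma C2_radial : C2 psi0.
Proof.
have cs : continuous (fun y : V => sqnorm (y - x) - s0).
  by move=> y; exact: (cvgB (@continuous_sqdist _ _ x y) (cvg_cst _)).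
have ci i : continuous (fun y : V => y 0 i - x 0 i).
  by move=> y; exact: (cvgB (@coord_continuous_rV _ _ i y) (cvg_cst _)).
have csl : continuous slope.
  by move=> y; exact: (cvgD (cvg_cst b) (cvgM (cvg_cst (2 * c)) (cs y))).
split; [|split; [|split; [|split]]].
- move=> y; apply: (cvgD (cvgM (cvg_cst _) (cs y)) (cvgM (cvg_cst _) _)).
  rewrite (_ : (fun _ => _) = (fun y : V => (sqnorm (y - x) - s0) * (sqnorm (y - x) - s0))) //.
  exact: (cvgM (cs y) (cs y)).
- by move=> i y; have := is_derive_radial y i => -[].
- move=> i; rewrite pderiv_radial => y.
  exact: (cvgM (csl y) (cvgM (cvg_cst _) (ci i y))).
- by move=> i j y; have := is_derive_pderiv_radial y i j => -[].
- move=> i j; rewrite pderiv2_radial => y.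
  exact: (cvgD
    (cvgM (cvgM (cvg_cst (2 : R)) (csl y)) (cvg_cst ((i == j)%:R : R)))
    (cvgM (cvgM (cvg_cst (8 * c)) (ci i y)) (ci j y))).
Qed.

Lemma grad_radial y : sqnorm (y - x) = s0 -> grad psi0 y = (2 * b) *: (y - x).
Proof.
by move=> ys; apply/rowP => i; rewrite !mxE pderiv_radial ys; ring.
Qed.

Lemma hess_radial y : sqnorm (y - x) = s0 ->
  hess psi0 y = (2 * b)%:M + (8 * c) *: ((y - x)^T *m (y - x)).
Proof.
move=> ys; apply/matrixP => i j; rewrite !mxE pderiv2_radial ys big_ord1 !mxE.
by rewrite mulr_natr subrr mulr0 addr0 mulrA.
Qed.

End TestFunctions.

(** * Pointwise viscosity inequalities tested with radial functions *)

Section Subtest.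
Variables (R : realType) (d : nat).
Local Notation V := 'rV[R]_d.
Implicit Types (p q x y z : V) (psi u : V -> R).

Lemma dotvC p q : dotv p q = dotv q p.
Proof. by apply: eq_bigr => i _; rewrite mulrC. Qed.

Lemma dotvDl p q z : dotv (p + q) z = dotv p z + dotv q z.
Proof. by rewrite -big_split; apply: eq_bigr => i _; rewrite mxE mulrDl. Qed.

Lemma dotvZl (a : R) p z : dotv (a *: p) z = a * dotv p z.
Proof. by rewrite mulr_sumr; apply: eq_bigr => i _; rewrite mxE mulrA. Qed.

Lemma mulmx_trE p q : (p *m q^T) 0 0 = dotv p q.
Proof. by rewrite !mxE; apply: eq_bigr => i _; rewrite !mxE. Qed.

Lemma mul_rank_one p q : p *m (q^T *m q) = dotv p q *: q.
Proof.
rewrite mulmxA; apply/rowP => i; rewrite mxE big_ord1 mulmx_trE.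
by rewrite !mxE.
Qed.

Lemma inflap_diamondZ (a : R) p (X : 'M[R]_d) : a != 0 ->
  inflap_diamond (a *: p) X = inflap_diamond p X.
Proof.
move=> a0; rewrite /inflap_diamond sqnormZ linearZ /= -scalemxAl -scalemxAl.
rewrite -scalemxAr !mxE invfM.
set m := (\sum_ _ _); set n := (sqnorm p)^-1.
by field.
Qed.

Lemma inflap_diamond_rank_one p (a e : R) : p != 0 ->
  inflap_diamond p (a%:M + e *: (p^T *m p)) = a + e * sqnorm p.
Proof.
move=> p0; rewrite /inflap_diamond mulmxDr mul_mx_scalar -scalemxAr mul_rank_one.
rewrite scalerA -scalerDl -scalemxAl mxE mulmx_trE -/(sqnorm p).
by rewrite mulrC -mulrA divff ?mulr1 // sqnorm_eq0.
Qed.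

(** Pairing an eigenvector with its own image and applying Cauchy-Schwarz bounds each eigenvalue. *)
Lemma lambda_max_rank_one p (a e : R) : (0 < d)%N -> 0 <= e ->
  lambda_max (a%:M + e *: (p^T *m p)) <= a + e * sqnorm p.
Proof.
move=> d0 e0.
have mulE q : q *m (a%:M + e *: (p^T *m p)) = a *: q + (e * dotv q p) *: p.
  by rewrite mulmxDr mul_mx_scalar -scalemxAr mul_rank_one scalerA.
(* The bound on [sup] requires some eigenvalue to exist: [p] is an eigenvector, or any basis vector
   when [p = 0], which is where [0 < d] enters. *)
apply: ge_sup => [|l /= /eigenvalueP[q]].
  have [p0|p0] := eqVneq p 0.
    exists a; apply/eigenvalueP; exists (ebase R (Ordinal d0)).
      by rewrite mulE p0 scaler0 addr0.
    apply/eqP => /rowP /(_ (Ordinal d0)); rewrite !mxE !eqxx => /eqP.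
    by rewrite oner_eq0.
  exists (a + e * sqnorm p); apply/eigenvalueP; exists p => //.
  by rewrite mulE -scalerDl.
move=> h q0.
have qq : 0 < sqnorm q by rewrite sqnorm_gt0.
have E : dotv (a *: q + (e * dotv q p) *: p) q = dotv (l *: q) q.
  by rewrite -h mulE.
move: E; rewrite dotvDl !dotvZl -/(sqnorm q) => E.
rewrite -(ler_pM2r qq) -E (dotvC p).
have := ler_wpM2l e0 (dotv_cauchy q p); lra.
Qed.

(** The inequality [- Delta u <= k] in the viscosity sense at the single point [y], free of the
    obstacle, so that it serves both for [w] and for [- v]. *)
Definition subtest u y (k : R) := forall psi, C2 psi ->
  (\forall z \near y, u z - psi z <= u y - psi y) -> - inflap_plus psi y <= k.

Lemma subtest_le u y (k l : R) : k <= l -> subtest u y k -> subtest u y l.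
Proof. by move=> kl su psi C2psi h; apply: le_trans kl; exact: su. Qed.

(** At [y] the test function has gradient [2 b (y - x)] and Hessian [2 b] times the identity plus
    [8 c] times a rank-one matrix in direction [y - x]. With nonzero gradient the operator is
    exactly the right-hand side; with zero gradient [c >= 0] is needed to bound the largest
    eigenvalue by it. *)
Lemma subtest_radial u x y (k b c : R) : (0 < d)%N -> subtest u y k ->
  (b != 0 /\ y != x) \/ 0 <= c ->
  (\forall z \near y, u z <= u y + b * (sqnorm (z - x) - sqnorm (y - x))
                           + c * (sqnorm (z - x) - sqnorm (y - x)) ^+ 2) ->
  - k <= 2 * b + 8 * c * sqnorm (y - x).
Proof.
move=> d0 su bc near_u.
pose s0 := sqnorm (y - x).
have : - inflap_plus (radial x s0 b c) y <= k.
  apply: su; first exact: C2_radial.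
  apply: filterS near_u => z; rewrite /radial -/s0 => hz.
  by rewrite subrr expr0n /= !mulr0; lra.
rewrite /inflap_plus grad_radial // hess_radial //.
case: ifPn => [|g0].
  rewrite scaler_eq0 negb_or => /andP[b0 yx].
  by rewrite inflap_diamondZ // inflap_diamond_rank_one // -/s0; lra.
have c0 : 0 <= c.
  case: bc => // -[b0 yx]; move: g0; rewrite negbK scaler_eq0 mulf_eq0.
  by rewrite pnatr_eq0 /= (negbTE b0) subr_eq0 (negbTE yx).
have c8 : 0 <= 8 * c by rewrite mulr_ge0.
have := lambda_max_rank_one (y - x) (2 * b) d0 c8; rewrite -/s0 => h1 h2.
by apply: le_trans h1; rewrite lerNl.
Qed.

End Subtest.

(** * From the obstacle problem to one-sided inequalities for [w] and [- v] *)

Section Viscosity.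
Variables (R : realType) (d : nat).
Local Notation V := 'rV[R]_d.
Implicit Types (x y z : V) (psi u : V -> R).

Lemma pderivN (i : 'I_d) psi : (forall x, derivable psi x (ebase R i)) ->
  pderiv i (fun z => - psi z) = fun z => - pderiv i psi z.
Proof. by move=> dpsi; apply/funext => z; rewrite /pderiv (deriveN (dpsi z)). Qed.

Lemma C2N psi : C2 psi -> C2 (fun z => - psi z).
Proof.
move=> [c0 [d1 [c1 [d2 c2]]]].
split; first by move=> y; exact: (cvgN (c0 y)).
split; first by move=> i y; exact: derivableN.
split; first by move=> i; rewrite pderivN // => y; exact: (cvgN (c1 i y)).
split; first by move=> i j y; rewrite pderivN //; exact: derivableN.
by move=> i j; rewrite pderivN // pderivN // => y; exact: (cvgN (c2 i j y)).
Qed.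

Lemma lambda_minN (A : 'M[R]_d) : lambda_min (- A) = - lambda_max A.
Proof.
rewrite /lambda_min /inf /lambda_max; congr (- sup _); apply/seteqP; split.
  move=> a [b /= /eigenvalueP[q qA q0] <-]; apply/eigenvalueP; exists q => //.
  by rewrite scaleNr -qA mulmxN opprK.
move=> a /= /eigenvalueP[q qA q0]; exists (- a); last exact: opprK.
by apply/eigenvalueP; exists q => //; rewrite mulmxN qA scaleNr.
Qed.

Lemma inflap_minusN psi y : C2 psi ->
  inflap_minus (fun z => - psi z) y = - inflap_plus psi y.
Proof.
move=> [c0 [d1 [c1 [d2 c2]]]].
have gN : grad (fun z => - psi z) y = - grad psi y.
  by apply/rowP => i; rewrite !mxE pderivN.
have hN : hess (fun z => - psi z) y = - hess psi y.
  by apply/matrixP => i j; rewrite !mxE pderivN // pderivN.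
rewrite /inflap_minus /inflap_plus gN hN oppr_eq0 lambda_minN; case: ifP => // _.
rewrite -scaleN1r inflap_diamondZ ?oppr_eq0 ?oner_eq0 //.
by rewrite /inflap_diamond mulmxN mulNmx mxE mulrN.
Qed.

Lemma visc_sub_subtest (O : set V) f chi w y :
  visc_sub O f chi w -> O y -> chi y < w y -> subtest w y (f y).
Proof.
move=> sub Oy chiw psi C2psi near_w.
by have := sub y psi Oy C2psi near_w; rewrite ge_min => /orP[]; lra.
Qed.

Lemma visc_super_subtest (O : set V) f chi v y :
  visc_super O f chi v -> O y -> subtest (fun z => - v z) y (- f y).
Proof.
move=> sup Oy psi C2psi near_v.
have : 0 <= Num.min (- inflap_minus (fun z => - psi z) y - f y) (v y - chi y).
  apply: (sup _ _ Oy (C2N C2psi)).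
  by apply: filterS near_v => z; lra.
by rewrite le_min inflap_minusN // => /andP[]; lra.
Qed.

End Viscosity.

(** * Comparison with quadratic cones and the midpoint inequality *)

Section ConeComparison.
Variables (R : realType) (d : nat).
Hypothesis d_gt0 : (0 < d)%N.
Local Notation V := 'rV[R]_d.
Implicit Types (x y z : V) (u : V -> R).

Definition enorm (p : V) : R := Num.sqrt (sqnorm p).

Lemma sqr_enorm p : enorm p ^+ 2 = sqnorm p.
Proof. by rewrite sqr_sqrtr // sqnorm_ge0. Qed.

Lemma enorm_ge0 p : 0 <= enorm p. Proof. exact: sqrtr_ge0. Qed.

Lemma eballP x (r : R) y : 0 <= r -> eball x r y <-> enorm (y - x) <= r.
Proof.
by move=> r0; rewrite /eball /= -sqr_enorm ler_pXn2r ?nnegrE ?enorm_ge0.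
Qed.

Lemma continuous_edist x : continuous (fun y => enorm (y - x)).
Proof.
move=> y; apply: (@continuous_comp _ _ _ (fun y => sqnorm (y - x)) Num.sqrt).
  exact: continuous_sqdist.
exact: sqrt_continuous.
Qed.

(** As a function of [r = |y - x|] with [r > 0], this profile satisfies [- Delta = K] wherever its
    slope [a - K r] does not vanish. *)
Definition cone (c a K r : R) : R := c + a * r - K / 2 * r ^+ 2.

(** Second-order Taylor expansion of the cone in the variable [s = |z - x|^2], where the cone reads
    [c + a sqrt(s) - K s / 2]; the extra [e] absorbs the remainder. *)
Lemma cone_near_le x y (c a K e : R) : y != x -> 0 < e ->
  \forall z \near y, cone c a K (enorm (z - x)) <= cone c a K (enorm (y - x))
    + (a / (2 * enorm (y - x)) - K / 2) * (sqnorm (z - x) - sqnorm (y - x))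
    + (- (a / (8 * enorm (y - x) ^+ 3)) + e) *
      (sqnorm (z - x) - sqnorm (y - x)) ^+ 2.
Proof.
move=> yx e0; set r0 := enorm (y - x).
have r0_gt0 : 0 < r0 by rewrite sqrtr_gt0 sqnorm_gt0 subr_eq0.
have r00 : r0 != 0 by rewrite gt_eqF.
(* Using [r - r0 = (s - s0) / (r + r0)], the right side minus the left side is exactly
   [(e - h z) (s - s0)^2], and [h] is continuous and vanishes at [y]. *)
pose h (z : V) := a / (2 * r0) *
  (((r0 + r0) * (r0 + r0))^-1 - ((enorm (z - x) + r0) * (enorm (z - x) + r0))^-1).
have rr00 : (r0 + r0) * (r0 + r0) != 0 by rewrite mulf_neq0 // gt_eqF // addr_gt0.
have c1 : enorm (z - x) + r0 @[z --> y] --> r0 + r0.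
  exact: (cvgD (@continuous_edist x y) (cvg_cst r0)).
have c2 : ((enorm (z - x) + r0) * (enorm (z - x) + r0))^-1 @[z --> y]
    --> ((r0 + r0) * (r0 + r0))^-1.
  exact: (cvgV rr00 (cvgM c1 c1)).
have c3 : ((r0 + r0) * (r0 + r0))^-1
    - ((enorm (z - x) + r0) * (enorm (z - x) + r0))^-1 @[z --> y]
    --> ((r0 + r0) * (r0 + r0))^-1 - ((r0 + r0) * (r0 + r0))^-1.
  exact: (cvgB (cvg_cst _) c2).
have ch : h z @[z --> y] --> h y.
  by rewrite {2}/h; apply: cvgM c3; exact: cvg_cst.
have h0 : h y = 0 by rewrite /h -/r0 subrr mulr0.
move: ch => /cvgrPdist_lt /(_ e e0); apply: filterS => z.
rewrite h0 sub0r normrN => hz.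
have hz1 : h z < e by apply: le_lt_trans hz; exact: ler_norm.
rewrite -!sqr_enorm -/r0 /cone; set r := enorm (z - x).
have r_ge0 : 0 <= r by exact: enorm_ge0.
have rr0 : r + r0 != 0 by rewrite gt_eqF // ltr_wpDl.
have H : 0 <= (e - h z) * (r ^+ 2 - r0 ^+ 2) ^+ 2.
  by rewrite mulr_ge0 ?sqr_ge0 // subr_ge0 ltW.
rewrite -subr_ge0; apply: le_trans H _; rewrite le_eqVlt /h -/r.
by apply/orP; left; apply/eqP; field; rewrite r00 rr0 gt_eqF // addr_gt0.
Qed.

(** Otherwise [u] minus the cone has a positive maximum, attained neither at the vertex nor on the
    sphere. There the cone touches [u] from above, and its value [- Delta = K] contradicts the
    strictly smaller [k]. *)
Lemma cone_comparison u x (rho c a K : R) : 0 < rho ->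
  usc_within (eball x rho) u -> u x <= c ->
  (forall y, enorm (y - x) = rho -> u y <= cone c a K rho) ->
  K < 0 \/ 0 < K /\ K * rho <= a ->
  (forall y, enorm (y - x) < rho -> cone c a K (enorm (y - x)) < u y ->
     exists2 k, k < K & subtest u y k) ->
  forall y, eball x rho y -> u y <= cone c a K (enorm (y - x)).
Proof.
move=> rho0 usc_u uxc u_sphere Ka u_test y xy.
rewrite leNgt; apply/negP => uy.
have ccone : continuous (fun z => - cone c a K (enorm (z - x))).
  have cN := @continuous_edist x.
  have c1 : continuous (fun z => c + a * enorm (z - x)).
    by move=> z; exact: (cvgD (cvg_cst c) (cvgM (cvg_cst a) (cN z))).
  have c2 : continuous (fun z => K / 2 * (enorm (z - x) * enorm (z - x))).
    by move=> z; exact: (cvgM (cvg_cst (K / 2)) (cvgM (cN z) (cN z))).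
  move=> z; exact: (cvgN (cvgB (c1 z) (c2 z))).
have [y0 xy0 y0max] := usc_argmax (@compact_eball _ _ x rho)
  (ex_intro _ x (eball_center x rho)) (usc_withinD usc_u (continuous_usc ccone)).
have uy0 : cone c a K (enorm (y0 - x)) < u y0 by have := y0max _ xy; lra.
have y0x : y0 != x.
  apply/eqP => E; move: uy0; rewrite E subrr /enorm sqnorm0 sqrtr0 /cone.
  by rewrite mulr0 expr0n mulr0 subr0 addr0; lra.
have r0_gt0 : 0 < enorm (y0 - x) by rewrite sqrtr_gt0 sqnorm_gt0 subr_eq0.
have r0rho : enorm (y0 - x) < rho.
  rewrite lt_def; move/(eballP _ _ (ltW rho0)): xy0 => ->; rewrite andbT.
  by apply/eqP => E; have := u_sphere _ (esym E); move: uy0; rewrite E; lra.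
have [k kK tk] := u_test _ r0rho uy0.
set r0 := enorm (y0 - x) in r0_gt0 r0rho.
have r00 : r0 != 0 by rewrite gt_eqF.
(* Chosen so that the error term [8 e r0^2] costs only half of the gap [K - k]. *)
pose e := (K - k) / (16 * r0 ^+ 2).
have e0 : 0 < e by rewrite divr_gt0 ?subr_gt0 // mulr_gt0 // exprn_gt0.
pose b := a / (2 * r0) - K / 2; pose C := - (a / (8 * r0 ^+ 3)) + e.
have bE : b = (a - K * r0) / (2 * r0) by rewrite /b; field.
(* If [K > 0], the slope [a - K r0] is positive because [r0 < rho]. If [K < 0], a vanishing slope
   means [a = K r0 < 0], which makes the second-order coefficient positive. *)
have bC : (b != 0 /\ y0 != x) \/ 0 <= C.
  case: Ka => [K0|[K0 Ka]]; last first.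
    left; split=> //; rewrite bE mulf_neq0 ?invr_eq0 ?mulf_neq0 //.
    rewrite gt_eqF // subr_gt0; apply: lt_le_trans Ka.
    by rewrite ltr_pM2l.
  have [b0|b0] := eqVneq b 0; last by left.
  right; have aE : a = K * r0.
    apply/eqP; rewrite -subr_eq0; move/eqP: b0; rewrite bE mulf_eq0 invr_eq0.
    by rewrite mulf_eq0 pnatr_eq0 /= (negbTE r00) orbF.
  rewrite /C aE -[X in X + e]mulNr addr_ge0 ?(ltW e0) //.
  by rewrite divr_ge0 ?mulr_ge0 ?exprn_ge0 ?(ltW r0_gt0) // oppr_ge0
     nmulr_rle0 ?(ltW r0_gt0).
have touch : \forall z \near y0, u z <= u y0
    + b * (sqnorm (z - x) - sqnorm (y0 - x))
    + C * (sqnorm (z - x) - sqnorm (y0 - x)) ^+ 2.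
  have n1 : \forall z \near y0, eball x rho z.
    have /cvgrPdist_lt := @continuous_edist x y0.
    have g0 : 0 < rho - r0 by rewrite subr_gt0.
    move=> /(_ _ g0); apply: filterS => z hz; apply/eballP; first exact: ltW.
    have := ler_norm (- (enorm (y0 - x) - enorm (z - x))).
    by rewrite normrN -/r0; rewrite -/r0 in hz; lra.
  apply: filterS2 n1 (cone_near_le c a K y0x e0) => z xz hz.
  by have := y0max _ xz; rewrite -/r0 -/b -/C in hz *; lra.
have := subtest_radial d_gt0 tk bC touch; rewrite -sqr_enorm -/r0.
have -> : 2 * b + 8 * C * r0 ^+ 2 = - K + (K - k) / 2.
  by rewrite /b /C /e; field.
by lra.
Qed.

(* Otherwise the paraboloid [- K / 2 |z - x|^2] would touch [u] from above inside
   the ball. *)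
Lemma subtest_negative_growth u x (e M k K : R) : 0 < e -> K < 0 -> k < K ->
  usc_within (eball x e) u -> (forall y, eball x e y -> u y <= M) ->
  (forall y, enorm (y - x) < e -> u x <= u y -> subtest u y k) ->
  u x <= M + K / 2 * e ^+ 2.
Proof.
move=> e0 K0 kK usc_u uM u_test.
have cq : continuous (fun z : V => K / 2 * sqnorm (z - x)).
  by move=> z; exact: (cvgM (cvg_cst (K / 2)) (@continuous_sqdist _ _ x z)).
have [y0 xy0 y0max] := usc_argmax (@compact_eball _ _ x e)
  (ex_intro _ x (eball_center x e)) (usc_withinD usc_u (continuous_usc cq)).
have := y0max _ (eball_center x e); rewrite subrr sqnorm0 mulr0 addr0 => uxy0.
have := uM _ xy0 => uy0M.
have s0_ge0 : 0 <= - K * sqnorm (y0 - x).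
  by rewrite mulr_ge0 ?sqnorm_ge0 // oppr_ge0 ltW.
have [r0e|r0e] := ltP (enorm (y0 - x)) e; last first.
  have : 0 <= - K * (sqnorm (y0 - x) - e ^+ 2).
    rewrite mulr_ge0 ?oppr_ge0 ?(ltW K0) // subr_ge0 -sqr_enorm.
    by rewrite ler_pXn2r // nnegrE ?enorm_ge0 ?(ltW e0).
  by lra.
have ty0 : subtest u y0 k by apply: u_test => //; lra.
suff touch : \forall z \near y0, u z <= u y0
    + - (K / 2) * (sqnorm (z - x) - sqnorm (y0 - x))
    + 0 * (sqnorm (z - x) - sqnorm (y0 - x)) ^+ 2.
  by have := subtest_radial d_gt0 ty0 (or_intror (lexx 0)) touch; lra.
have n1 : \forall z \near y0, eball x e z.
  have /cvgrPdist_lt := @continuous_edist x y0.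
  have g0 : 0 < e - enorm (y0 - x) by rewrite subr_gt0.
  move=> /(_ _ g0); apply: filterS => z hz; apply/eballP; first exact: ltW.
  have := ler_norm (- (enorm (y0 - x) - enorm (z - x))).
  by rewrite normrN; lra.
by apply: filterS n1 => z xz; have := y0max _ xz; lra.
Qed.

Lemma subtest_midpoint_strict u x (e M k K : R) : 0 < e -> k < K -> K != 0 ->
  usc_within (eball x (2 * e)) u -> (forall y, eball x (2 * e) y -> u y <= M) ->
  (forall y, enorm (y - x) < 2 * e -> u x <= u y -> subtest u y k) ->
  forall y, eball x e y -> 2 * u y <= M + u x + e ^+ 2 * K.
Proof.
move=> e0 kK K0 usc_u uM u_test y xy.
have e2 : 0 < 2 * e by rewrite mulr_gt0.
have e00 : e != 0 by rewrite gt_eqF.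
have uxM : u x <= M by apply: uM; exact: eball_center.
have re : enorm (y - x) <= e by apply/eballP => //; exact: ltW.
have r_ge0 := enorm_ge0 (y - x).
(* The slope for which the cone with vertex value [u x] takes the value [M] at radius [2 e]; its
   value at radius [e] is then half of the claimed bound. *)
pose a := (M - u x) / (2 * e) + K * e.
have cone_e : cone (u x) a K e = (M + u x + e ^+ 2 * K) / 2.
  by rewrite /cone /a; field.
have cone_2e : cone (u x) a K (2 * e) = M by rewrite /cone /a; field.
have [Kn|Kp|/eqP] := ltgtP K 0; last by rewrite (negbTE K0).
  have := subtest_negative_growth e2 Kn kK usc_u uM u_test => h.
  (* [a >= 0] is the growth estimate [h] divided by [2 e]. It keeps the cone above [u x], so the
     test is needed only where [u x <= u z]. *)
  have a0 : 0 <= a.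
    rewrite (_ : a = (M + K / 2 * (2 * e) ^+ 2 - u x) / (2 * e)).
      by rewrite divr_ge0 ?(ltW e2) // subr_ge0.
    by rewrite /a; field.
  have cone_ge r : 0 <= r -> u x <= cone (u x) a K r.
    move=> r0; have := mulr_ge0 a0 r0.
    have : 0 <= - K * r ^+ 2 by rewrite mulr_ge0 ?sqr_ge0 // oppr_ge0 ltW.
    by rewrite /cone; lra.
  have xy2 : eball x (2 * e) y by apply/eballP; lra.
  have : u y <= cone (u x) a K (enorm (y - x)).
    apply: (@cone_comparison u x (2 * e)) => //.
    - by move=> z zE; rewrite cone_2e; apply: uM; apply/eballP; rewrite ?zE ?(ltW e2).
    - by left.
    - move=> z rz uz; exists k => //; apply: u_test => //.
      by apply: le_trans (ltW uz); apply: cone_ge; exact: enorm_ge0.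
  have : 0 <= a * (e - enorm (y - x)) by rewrite mulr_ge0 // subr_ge0.
  have : 0 <= - K * (e ^+ 2 - enorm (y - x) ^+ 2).
    rewrite mulr_ge0 ?oppr_ge0 ?(ltW Kn) // subr_ge0.
    by rewrite ler_pXn2r // nnegrE ?(ltW e0).
  by move: cone_e; rewrite /cone; lra.
have Ke : 0 <= K * e by rewrite mulr_ge0 ?ltW.
have aKe : K * e <= a.
  by rewrite lerDr divr_ge0 ?subr_ge0 // ltW.
(* For [K > 0] the cone peaks at radius [a / K], possibly before [2 e]. Stopping there keeps the
   slope nonnegative, and the peak value is still at least [M]. *)
pose rho := Num.min (2 * e) (a / K).
have rho2e : rho <= 2 * e by rewrite ge_min lexx.
have e_rho : e <= rho by rewrite le_min ler_pdivlMr // (mulrC e K) aKe andbT; lra.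
have Krho : K * rho <= a.
  by rewrite mulrC -ler_pdivlMr // ge_min lexx orbT.
have rho0 : 0 < rho by apply: lt_le_trans e_rho.
have M_rho : M <= cone (u x) a K rho.
  rewrite -cone_2e /rho; case: (leP (2 * e) (a / K)) => // h.
  have aK : a / K * K = a by rewrite divfK.
  have : 0 <= K * (2 * e - a / K) ^+ 2 by rewrite mulr_ge0 ?sqr_ge0 // ltW.
  by rewrite /cone; set t := a / K in aK *; rewrite -aK; lra.
have cone_ge r : 0 <= r -> r <= rho -> u x <= cone (u x) a K r.
  move=> r0 r1; have h : 0 <= r * (a - K * r).
    rewrite mulr_ge0 // subr_ge0; apply: le_trans Krho.
    by rewrite ler_pM2l.
  have : 0 <= K * r ^+ 2 by rewrite mulr_ge0 ?sqr_ge0 // ltW.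
  by rewrite /cone; lra.
have sub z : eball x rho z -> eball x (2 * e) z.
  move=> /(eballP _ _ (ltW rho0)) h; apply/eballP; first exact: ltW.
  exact: le_trans rho2e.
have xy2 : eball x rho y by apply/eballP; [exact: ltW|exact: le_trans e_rho].
have : u y <= cone (u x) a K (enorm (y - x)).
  apply: (@cone_comparison u x rho) => //.
  - exact: usc_within_sub usc_u.
  - move=> z zE; apply: le_trans M_rho; apply: uM; apply: sub.
    by apply/eballP; rewrite ?zE ?(ltW rho0).
  - by right.
  - move=> z rz uz; exists k => //; apply: u_test; first exact: lt_le_trans rho2e.
    apply: le_trans (ltW uz); apply: cone_ge; [exact: enorm_ge0|exact: ltW].
set r := enorm (y - x) in re r_ge0 * => h1.
(* The cone at [e] exceeds the cone at [r] by [(e - r) (a - K e) + K (e - r)^2 / 2]. *)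
have : 0 <= (e - r) * (a - K * e) by rewrite mulr_ge0 ?subr_ge0.
have : 0 <= K * (e - r) ^+ 2 by rewrite mulr_ge0 ?sqr_ge0 // ltW.
by move: cone_e h1; rewrite /cone; lra.
Qed.

(** The strict version holds for every nonzero [K > k]; a violation by a positive gap is excluded by
    taking [K] close enough to [k]. *)
Lemma subtest_midpoint u x (e M k : R) : 0 < e ->
  usc_within (eball x (2 * e)) u -> (forall y, eball x (2 * e) y -> u y <= M) ->
  (forall y, enorm (y - x) < 2 * e -> u x <= u y -> subtest u y k) ->
  forall y, eball x e y -> 2 * u y <= M + u x + e ^+ 2 * k.
Proof.
move=> e0 usc_u uM u_test y xy; rewrite leNgt; apply/negP => gap.
pose g := (2 * u y - (M + u x + e ^+ 2 * k)) / e ^+ 2.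
have e20 : 0 < e ^+ 2 by rewrite exprn_gt0.
have g0 : 0 < g by rewrite divr_gt0 // subr_gt0.
have gE : e ^+ 2 * g = 2 * u y - (M + u x + e ^+ 2 * k).
  by rewrite /g mulrC divfK // gt_eqF.
have [K [K0 kK Kg]] : exists K, [/\ K != 0, k < K & K < k + g].
  (* At most one of the two candidates is zero. *)
  have [h|h] := eqVneq (k + g / 2) 0; [exists (k + g / 3)|exists (k + g / 2)].
    by split; [apply/eqP; lra|lra|lra].
  by split => //; lra.
have := subtest_midpoint_strict e0 kK K0 usc_u uM u_test xy.
have : e ^+ 2 * K < e ^+ 2 * (k + g) by rewrite ltr_pM2l.
by rewrite mulrDr gE; lra.
Qed.

(** Raising the vertex to [Num.max (u x) X] keeps the cone above [X], so only points with [u > X]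
    are tested. With [X] above the obstacle, this controls [w] before the obstacle is known to be
    inactive at the centre. *)
Lemma subtest_growth u x (rho X M K : R) : 0 < rho -> 0 < K -> X <= M ->
  usc_within (eball x rho) u -> (forall y, eball x rho y -> u y <= M) ->
  (forall y, enorm (y - x) < rho -> X < u y -> exists2 k, k < K & subtest u y k) ->
  forall y, eball x rho y ->
    u y <= Num.max (u x) X + ((M - X) / rho + K * rho) * enorm (y - x).
Proof.
move=> rho0 K0 XM usc_u uM u_test y xy.
have rho00 : rho != 0 by rewrite gt_eqF.
set c := Num.max (u x) X.
have uxc : u x <= c by rewrite le_max lexx.
have Xc : X <= c by rewrite le_max lexx orbT.
have cM : c <= M by rewrite ge_max XM andbT; apply: uM; exact: eball_center.
(* Makes the cone at least [M] on the sphere while keeping it increasing up to [rho]. *)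
pose a := (M - c) / rho + K * rho.
have aK : K * rho <= a by rewrite lerDr divr_ge0 ?subr_ge0 // ltW.
have cone_rho : M <= cone c a K rho.
  have -> : cone c a K rho = M + K * rho ^+ 2 / 2 by rewrite /cone /a; field.
  by rewrite lerDl divr_ge0 // mulr_ge0 ?sqr_ge0 // ltW.
have cone_ge r : 0 <= r -> r <= rho -> c <= cone c a K r.
  move=> r0 r1; have h : 0 <= r * (a - K * r).
    rewrite mulr_ge0 // subr_ge0; apply: le_trans aK.
    by rewrite ler_pM2l.
  have : 0 <= K * r ^+ 2 by rewrite mulr_ge0 ?sqr_ge0 // ltW.
  by rewrite /cone; lra.
have : u y <= cone c a K (enorm (y - x)).
  apply: (@cone_comparison u x rho) => //.
  - move=> z zE; apply: le_trans cone_rho; apply: uM.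
    by apply/eballP; rewrite ?zE ?(ltW rho0).
  - by right.
  - move=> z rz uz; apply: u_test => //; apply: le_lt_trans uz.
    apply: (le_trans Xc); apply: cone_ge; [exact: enorm_ge0|exact: ltW].
have r_ge0 := enorm_ge0 (y - x).
have : 0 <= ((c - X) / rho) * enorm (y - x).
  by rewrite mulr_ge0 // divr_ge0 ?subr_ge0 // ltW.
have : 0 <= K * enorm (y - x) ^+ 2 by rewrite mulr_ge0 ?sqr_ge0 // ltW.
by rewrite /cone /a; lra.
Qed.

End ConeComparison.

(** * Extremal pairs of the doubled functional *)

Section Doubling.
Variables (R : realType) (d : nat).
Local Notation V := 'rV[R]_d.
Implicit Types (K O : set V) (x y z m q : V) (w v f chi : V -> R).

Lemma usc_within_comp (S T : topologicalType) (g : S -> T) (A : set T) (B : set S)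
    (F : T -> R) : continuous g -> (forall s, B s -> A (g s)) ->
  usc_within A F -> usc_within B (F \o g).
Proof.
move=> cg BA uF s Bs e e0.
have : \forall t \near s, A (g t) -> F (g t) < F (g s) + e.
  exact: (cg s _ (uF _ (BA _ Bs) e e0)).
by apply: filterS => t /= Ft Bt; apply: Ft; exact: BA.
Qed.

Definition close_pair K (e : R) y z := [/\ K y, K z & sqnorm (y - z) <= (2 * e) ^+ 2].

(* The last two clauses break ties; they only matter when the right-hand side
   vanishes. *)
Definition extremal_pair K w v (a e : R) (i : 'I_d) y z :=
  [/\ close_pair K e y z,
   forall y' z', close_pair K e y' z' -> a * w y' - v z' <= a * w y - v z,
   forall y' z', close_pair K e y' z' -> a * w y' - v z' = a * w y - v z ->
     w y' <= w y &
   forall y' z', close_pair K e y' z' -> a * w y' - v z' = a * w y - v z ->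
     w y' = w y -> y' 0 i + z' 0 i <= y 0 i + z 0 i].

(** Three successive maximisations, each over the compact set of maximisers of the previous one. *)
Lemma extremal_pair_exists K w v (a e : R) (i : 'I_d) : compact K -> K !=set0 ->
  usc_within K w -> usc_within K (fun z => - v z) -> 0 < a ->
  exists y z, extremal_pair K w v a e i y z.
Proof.
move=> cK [k0 Kk0] uw uv a0.
pose T := [set p : V * V | close_pair K e p.1 p.2].
have c1 : continuous (fst : V * V -> V) by move=> p; exact: cvg_fst.
have c2 : continuous (snd : V * V -> V) by move=> p; exact: cvg_snd.
have cT : compact T.
  have cB : continuous (fun p : V * V => p.1 - p.2).
    by move=> p; exact: (cvgB (c1 p) (c2 p)).
  have cs : continuous (fun p : V * V => - sqnorm (p.1 - p.2 - 0)).
    move=> p; have := continuous_comp (cB p) (@continuous_sqdist _ _ 0 (p.1 - p.2)).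
    by move=> h; exact: (cvgN h).
  have := @compact_usc_superlevel _ _ _ _ (- (2 * e) ^+ 2) (compact_setX cK cK)
    (continuous_usc cs).
  congr (compact _); apply/seteqP; split => p /=.
    by case=> -[K1 K2]; rewrite lerN2 subr0.
  by case=> K1 K2; rewrite lerN2 subr0.
have T0 : T !=set0.
  by exists (k0, k0); split => //=; rewrite subrr sqnorm0 sqr_ge0.
have T1 p : T p -> K p.1 by case.
have T2 p : T p -> K p.2 by case.
have uF := usc_withinD (usc_withinZ a0 (usc_within_comp c1 T1 uw))
  (usc_within_comp c2 T2 uv).
have [E10 cE1] := usc_argmax_compact cT T0 uF.
set E1 := [set p | _] in E10 cE1.
have [E20 cE2] := usc_argmax_compact cE1 E10
  (usc_within_comp c1 (fun p (E1p : E1 p) => T1 p E1p.1) uw).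
set E2 := [set p | _] in E20 cE2.
have cG : continuous (fun p : V * V => p.1 0 i + p.2 0 i).
  move=> p; have h1 := continuous_comp (c1 p) (@coord_continuous_rV _ _ i p.1).
  have h2 := continuous_comp (c2 p) (@coord_continuous_rV _ _ i p.2).
  exact: (cvgD h1 h2).
have [[y z] [[Tyz max1] max2] max3] := usc_argmax cE2 E20 (continuous_usc cG).
exists y, z; split => //.
- by move=> y' z' h; exact: (max1 (y', z') h).
- move=> y' z' h hE; apply: (max2 (y', z')); split => // p Tp /=.
  by rewrite hE; exact: max1.
- move=> y' z' h hE hw; apply: (max3 (y', z')); split; first split => //.
    by move=> p Tp /=; rewrite hE; exact: max1.
  by move=> p E1p /=; rewrite hw; exact: max2.
Qed.

Lemma extremal_pair_cluster K w v (a M0 : R) (i : 'I_d) x0 : compact K -> K x0 ->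
  usc_within K w -> usc_within K (fun z => - v z) -> 0 < a ->
  M0 <= a * w x0 - v x0 ->
  exists x, [/\ K x, M0 <= a * w x - v x &
    forall r e1 : R, 0 < r -> 0 < e1 -> exists e y z, [/\ 0 < e, e < e1,
      extremal_pair K w v a e i y z, sqnorm (y - x) < r & M0 <= a * w y - v z]].
Proof.
move=> cK Kx0 uw uv a0 M0x0.
pose A (e1 : R) := [set y | exists e z, [/\ 0 < e, e < e1 &
   extremal_pair K w v a e i y z]].
(* First components of extremal pairs of scale below [e1], as [e1] shrinks; compactness of [K]
   provides a cluster point. *)
pose G := filter_from [set e | 0 < e] A.
have fG : Filter G.
  apply: filter_from_filter; first by exists 1; rewrite /= ltr01.
  move=> e1 e2 /= e10 e20; exists (Num.min e1 e2) => /=; first by rewrite lt_min e10.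
  move=> y [e [z [e0]]]; rewrite lt_min => /andP[h1 h2] ex.
  by split; exists e, z.
have PG : ProperFilter G.
  apply: filter_from_proper => // e1 /= e10.
  have [y [z ex]] := extremal_pair_exists (e1 / 2) i cK (ex_intro _ _ Kx0) uw uv a0.
  exists y, (e1 / 2), z; split => //; first by rewrite divr_gt0.
  by rewrite ltr_pdivrMr // ltr_pMr // ltr1n.
have GK : G K.
  by exists 1; [rewrite /= ltr01|move=> y [e [z [_ _ [[]]]]]].
have [x [Kx clx]] := cK G PG GK.
have H (r e1 : R) : 0 < r -> 0 < e1 -> exists e y z, [/\ 0 < e, e < e1,
      extremal_pair K w v a e i y z, sqnorm (y - x) < r & M0 <= a * w y - v z].
  move=> r0 e10; have GA : G (A e1) by exists e1.
  have [y [[e [z [e0 ee1 ex]]] yr]] := clx _ _ GA (near_sqdist x r0).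
  exists e, y, z; split => //; apply: (le_trans M0x0); case: ex => _ + _ _.
  by apply; split => //; rewrite subrr sqnorm0 sqr_ge0.
exists x; split => //; rewrite leNgt; apply/negP => gap.
pose g := M0 - (a * w x - v x).
have g2 : 0 < g / 2 by rewrite divr_gt0 // subr_gt0.
have hn : \forall y \near x, (K y -> a * w y < a * w x + g / 2) /\
    (K y -> - v y < - v x + g / 2).
  exact: filterI (usc_withinZ a0 uw Kx g2) (uv x Kx _ g2).
have [r r0 hr] := near_sqdistP hn.
(* With [e < r / 4] and [|y - x|^2 < r^2 / 4], doubling gives
   [|z - x|^2 <= 8 e^2 + 2 |y - x|^2 <= r^2], so semicontinuity at [x] applies to both [y] and
   [z]. *)
have r4 : 0 < r / 4 by rewrite divr_gt0.
have r24 : 0 < r ^+ 2 / 4 by rewrite divr_gt0 // exprn_gt0.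
have [e [y [z [e0 er [[Ky Kz yz] _ _ _] yx M0yz]]]] := H _ _ r24 r4.
have e2 : e ^+ 2 <= (r / 4) ^+ 2 by rewrite ler_pXn2r // ?nnegrE ltW.
have zx := sqnorm_dist_le z y x; rewrite sqnormBC in yz.
have [+ _] := hr y ltac:(lra); have [_ +] := hr z ltac:(lra).
by move=> /(_ Kz) h1 /(_ Ky) h2; rewrite /g in h1 h2; lra.
Qed.

(** With [y'] and [z'] maximising [w] and [- v] on the ball of radius [2 e], the pairs [(y', m)] and
    [(m, z')] are admissible. The sum of the two midpoint inequalities bounds twice the maximum by
    the values of these pairs plus [e^2 (a k1 + k2)]. If [k1 = k2 = 0], both pairs are maximal, and
    the tie-break on [w] forces [w m = w y' = w y]. *)
Lemma extremal_pair_center K w v (a e k1 k2 : R) (i : 'I_d) y z m : (0 < d)%N ->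
  extremal_pair K w v a e i y z -> 0 < a -> 0 < e ->
  eball m e y -> eball m e z -> eball m (2 * e) `<=` K ->
  usc_within K w -> usc_within K (fun z => - v z) ->
  (forall q, enorm (q - m) < 2 * e -> w m <= w q -> subtest w q k1) ->
  (forall q, enorm (q - m) < 2 * e -> subtest (fun z => - v z) q k2) ->
  0 <= a * k1 + k2 /\ (k1 = 0 -> k2 = 0 ->
    a * w m - v m = a * w y - v z /\ w m = w y).
Proof.
move=> d0 [_ max1 max2 _] a0 e0 my mz mK uw uv tw tv.
have uw' := usc_within_sub mK uw; have uv' := usc_within_sub mK uv.
have m0 : eball m (2 * e) !=set0 by exists m; exact: eball_center.
have [y' my' y'max] := usc_argmax (@compact_eball _ _ m (2 * e)) m0 uw'.
have [z' mz' z'max] := usc_argmax (@compact_eball _ _ m (2 * e)) m0 uv'.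
have hw := subtest_midpoint d0 e0 uw' y'max tw my.
have hv := subtest_midpoint d0 e0 uv' z'max (fun q h _ => tv q h) mz.
have Km : K m by apply: mK; exact: eball_center.
have p1 : close_pair K e y' m by split => //; exact: mK.
have p2 : close_pair K e m z' by split => //; [exact: mK|rewrite sqnormBC].
have h1 := max1 _ _ p1; have h2 := max1 _ _ p2.
have ahw : a * (2 * w y) <= a * (w y' + w m + e ^+ 2 * k1) by rewrite ler_pM2l.
split.
  have : 0 <= e ^+ 2 * (a * k1 + k2) by lra.
  by rewrite pmulr_rge0 // exprn_gt0.
move=> k10 k20; rewrite k10 k20 in hw hv ahw.
have E1 : a * w y' - v m = a * w y - v z by lra.
have E2 : a * w m - v z' = a * w y - v z by lra.
have g1 := max2 _ _ p1 E1; have g2 := max2 _ _ p2 E2.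
have wm : w m = w y by lra.
have wy' : w y' = w y by lra.
by split => //; rewrite -E1 wm wy'.
Qed.

End Doubling.

(** * Supersolutions lie above the obstacle *)

Section Obstacle.
Variables (R : realType) (d : nat).
Local Notation V := 'rV[R]_d.
Implicit Types (O : set V) (x y z m q : V) (w v f chi : V -> R).

(** A steep concave paraboloid centred at [x] touches [v] from below at some nearby [y0] with
    [v y0 <= v x]. The test there gives [chi y0 <= v y0], which continuity of [chi] excludes if
    [v x < chi x]. *)
Lemma visc_super_ge_obstacle O f chi v x : open O -> O x ->
  usc_within O (fun z => - v z) -> {in O, continuous chi} ->
  visc_super O f chi v -> chi x <= v x.
Proof.
move=> oO Ox uv cchi sup; rewrite leNgt; apply/negP => gap.
have g0 : 0 < chi x - v x by rewrite subr_gt0.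
have /cvgrPdist_lt /(_ _ g0) nchi := cchi x (mem_set Ox).
have hn : \forall z \near x, O z /\ `|chi x - chi z| < chi x - v x.
  exact: filterI (open_nbhs_nbhs (conj oO Ox)) nchi.
have [e e0 he] := near_sqdistP hn.
have eO : eball x e `<=` O by move=> z /he[].
have uv' := usc_within_sub eO uv.
have ex0 : eball x e !=set0 by exists x; exact: eball_center.
have [y1 xy1 y1max] := usc_argmax (@compact_eball _ _ x e) ex0 uv'.
(* Steep enough that the penalty at radius [e] exceeds the possible decrease of [v], so that the
   minimum of the penalised [v] is not on the sphere. *)
pose n := (v x - v y1 + 1) / e ^+ 2.
have e2 : 0 < e ^+ 2 by rewrite exprn_gt0.
have nE : n * e ^+ 2 = v x - v y1 + 1 by rewrite divfK // gt_eqF.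
have cq : continuous (fun z : V => - n * sqnorm (z - x)).
  by move=> z; exact: (cvgM (cvg_cst (- n)) (@continuous_sqdist _ _ x z)).
have [y0 xy0 y0max] := usc_argmax (@compact_eball _ _ x e) ex0
  (usc_withinD uv' (continuous_usc cq)).
have hx := y0max _ (eball_center x e); rewrite subrr sqnorm0 in hx.
have hy0 := y1max _ xy0.
have n0 : 0 < n.
  by rewrite divr_gt0 //; have := y1max _ (eball_center x e); lra.
have s0_ge0 : 0 <= n * sqnorm (y0 - x) by rewrite mulr_ge0 ?sqnorm_ge0 // ltW.
have s0e : sqnorm (y0 - x) < e ^+ 2.
  by rewrite -(ltr_pM2l n0) nE; lra.
have [Oy0 hchi] := he _ xy0.
have touch : \forall z \near y0, v z - radial x 0 (- n) 0 z >=
    v y0 - radial x 0 (- n) 0 y0.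
  have /cvgrPdist_lt := @continuous_sqdist _ _ x y0.
  have g1 : 0 < e ^+ 2 - sqnorm (y0 - x) by rewrite subr_gt0.
  move=> /(_ _ g1); apply: filterS => z hz.
  have xz : eball x e z.
    have := ler_norm (- (sqnorm (y0 - x) - sqnorm (z - x))).
    by rewrite normrN /eball /=; lra.
  by have := y0max _ xz; rewrite /radial; lra.
have := sup y0 _ Oy0 (C2_radial x 0 (- n) 0) touch.
rewrite le_min => /andP[_ h].
have := ler_norm (chi x - chi y0); lra.
Qed.

End Obstacle.

(** * Excluding an interior cluster point *)

Section Comparison.
Variables (R : realType) (d : nat).
Local Notation V := 'rV[R]_d.
Implicit Types (K O : set V) (x y z m q : V) (w v f chi : V -> R).

Lemma no_interior_cluster K O f chi w v (a M0 k1 k2 : R) (i : 'I_d) x :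
  open O -> O `<=` K -> O x ->
  usc_within K w -> usc_within K (fun z => - v z) -> {in O, continuous chi} ->
  visc_sub O f chi w -> visc_super O f chi v ->
  0 < a -> a <= 2 -> 0 < M0 -> (a - 1) * chi x <= M0 / 4 ->
  (\forall q \near x, f q <= k1 /\ - f q <= k2) ->
  a * k1 + k2 < 0 \/ k1 = 0 /\ k2 = 0 ->
  ~ (forall r e1 : R, 0 < r -> 0 < e1 -> exists e y z, [/\ 0 < e, e < e1,
      extremal_pair K w v a e i y z, sqnorm (y - x) < r & M0 <= a * w y - v z]).
Proof.
move=> oO OK Ox uw uv cchi sub sup a0 a2 M00 aM0 nf k12 H.
have d0 : (0 < d)%N by apply: leq_ltn_trans (ltn_ord i).
have v_chi q : O q -> chi q <= v q.
  move=> Oq; apply: (visc_super_ge_obstacle oO Oq _ cchi sup).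
  exact: usc_within_sub uv.
have M016 : 0 < M0 / 16 by rewrite divr_gt0.
have /cvgrPdist_lt /(_ _ M016) nchi := cchi x (mem_set Ox).
have [p p0 hp] : exists2 p : R, 0 < p & forall q, eball x p q ->
    [/\ O q, f q <= k1, - f q <= k2, `|chi x - chi q| < M0 / 16 & w q < w x + 1].
  apply: near_sqdistP.
  apply: filterS3 (filterI (open_nbhs_nbhs (conj oO Ox)) nf) nchi
    (uw x (OK _ Ox) 1 ltr01) => q [Oq [f1 f2]] hq wq.
  by split => //; apply: wq; exact: OK.
(* A level just above the obstacle on the whole ball: [w > X] makes it inactive. *)
pose X := chi x + M0 / 16.
have chiX q : eball x p q -> chi q < X.
  by move=> /hp[_ _ _ h _]; have := ler_norm (- (chi x - chi q)); rewrite normrN /X; lra.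
have chi_ge q : eball x p q -> chi x - M0 / 16 < chi q.
  by move=> /hp[_ _ _ h _]; have := ler_norm (chi x - chi q); lra.
pose Mw := Num.max (w x + 1) X.
have p20 : 0 < p / 2 by rewrite divr_gt0.
pose F := `|k1| + 1.
have F0 : 0 < F by rewrite ltr_wpDl.
have k1F : k1 < F by have := ler_norm k1; rewrite /F; lra.
pose L := (Mw - X) / (p / 2) + F * (p / 2).
have L0 : 0 < L.
  rewrite ltr_wpDl ?mulr_gt0 // divr_ge0 ?(ltW p20) // subr_ge0 le_max lexx orbT //.
(* The first bound keeps all centres used below well inside the ball; the second limits the growth
   of [w] over a distance [e] to [M0 / 16]. *)
pose e1 := Num.min (p / 16) (M0 / (16 * L)).
have e10 : 0 < e1 by rewrite lt_min !divr_gt0 ?mulr_gt0.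
have r0 : 0 < p ^+ 2 / 64 by rewrite divr_gt0 ?exprn_gt0.
have [e [y [z [e0 ee1 ex yx Myz]]]] := H _ _ r0 e10.
have [ep eL] : e < p / 16 /\ e * L < M0 / 16.
  move: ee1; rewrite lt_min => /andP[-> h]; split => //.
  rewrite -ltr_pdivlMr //; apply: lt_le_trans h _.
  by rewrite invfM mulrA.
have e2 : e ^+ 2 <= p ^+ 2 / 256.
  have -> : p ^+ 2 / 256 = (p / 16) ^+ 2 by field.
  by rewrite ler_pXn2r // ?nnegrE ?ltW ?divr_gt0.
have inner m : sqnorm (m - x) <= p ^+ 2 / 4 -> eball m (p / 2) `<=` eball x p.
  move=> mx q; rewrite /eball /= => mq; have := sqnorm_dist_le q m x.
  have E : (p / 2) ^+ 2 = p ^+ 2 / 4 by field.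
  by rewrite E in mq; lra.
have e_p2 : 2 * e <= p / 2 by lra.
have e2_p2 : (2 * e) ^+ 2 <= (p / 2) ^+ 2.
  by rewrite ler_pXn2r // nnegrE ?mulr_ge0 ?ltW.
have step m y' z' : extremal_pair K w v a e i y' z' -> M0 <= a * w y' - v z' ->
    sqnorm (m - x) <= p ^+ 2 / 4 -> eball m e y' -> eball m e z' ->
    [/\ k1 = 0, k2 = 0, a * w m - v m = a * w y' - v z' & w m = w y'].
  move=> ex' My'z' mx my' mz'.
  have sm := inner m mx.
  have e_2e (q : V) : eball m e q -> eball m (2 * e) q.
    rewrite /eball /= => h; apply: (le_trans h).
    by rewrite ler_pXn2r // ?nnegrE; lra.
  have s2e : eball m (2 * e) `<=` eball x p.
    by move=> q mq; apply: sm; exact: le_trans e2_p2.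
  (* If [w m <= X], the growth estimate gives [w y' <= X + M0 / 16]. With
     [v z' >= chi z' > chi x - M0 / 16], the pair value is then below
     [(a - 1) chi x + a M0 / 8 + M0 / 16], hence below [M0]. *)
  have wm : X < w m.
    have subu : eball m (p / 2) `<=` K by move=> q /sm/hp[/OK].
    have XMw : X <= Mw by rewrite le_max lexx orbT.
    have wMw q : eball m (p / 2) q -> w q <= Mw.
      by move=> /sm/hp[_ _ _ _ h]; rewrite le_max ltW.
    have tw q : enorm (q - m) < p / 2 -> X < w q -> exists2 k, k < F & subtest w q k.
      move=> qm Xq; have xq : eball x p q.
        by apply: sm; apply/eballP; exact: ltW.
      have [Oq fq _ _ _] := hp _ xq.
      exists (f q); first exact: le_lt_trans k1F.
      apply: (visc_sub_subtest sub Oq).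
      exact: lt_trans (chiX _ xq) Xq.
    have my2 : eball m (p / 2) y' by apply: le_trans e2_p2; exact: e_2e.
    have := subtest_growth d0 p20 F0 XMw (usc_within_sub subu uw) wMw tw my2.
    rewrite -/L => hg.
    have ye : enorm (y' - m) <= e by apply/eballP => //; exact: ltW.
    have Le : L * enorm (y' - m) <= e * L by rewrite mulrC ler_pM2r.
    have xz : eball x p z' by apply/s2e/e_2e.
    have [Oz _ _ _ _] := hp _ xz.
    have hz := v_chi _ Oz; have hcz := chi_ge _ xz.
    rewrite ltNge; apply/negP => wmX.
    have mX : Num.max (w m) X = X by apply/max_idPr.
    rewrite mX in hg.
    have : a * w y' <= a * (X + M0 / 16) by rewrite ler_pM2l //; lra.
    have : (2 - a) * M0 >= 0 by rewrite mulr_ge0 ?subr_ge0 // ltW.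
    by rewrite /X; lra.
  have tw q : enorm (q - m) < 2 * e -> w m <= w q -> subtest w q k1.
    move=> qm wq; have xq : eball x p q.
      by apply: s2e; apply/eballP; [lra|exact: ltW].
    have [Oq fq _ _ _] := hp _ xq.
    apply: subtest_le fq _; apply: (visc_sub_subtest sub Oq).
    by apply: lt_trans (chiX _ xq) _; exact: lt_le_trans wq.
  have tv q : enorm (q - m) < 2 * e -> subtest (fun z => - v z) q k2.
    move=> qm; have xq : eball x p q.
      by apply: s2e; apply/eballP; [lra|exact: ltW].
    have [Oq _ fq _ _] := hp _ xq.
    by apply: subtest_le fq _; exact: (visc_super_subtest sup Oq).
  have mK : eball m (2 * e) `<=` K by move=> q /s2e/hp[/OK].
  have [ge0] := extremal_pair_center d0 ex' a0 e0 my' mz' mK uw uv tw tv.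
  case: k12 => [|[-> ->]]; first by rewrite ltNge ge0.
  by move=> /(_ erefl erefl)[].
(* The midpoint is within [e] of both components. *)
pose m := 2^-1 *: (y + z).
have my : y - m = 2^-1 *: (y - z).
  by rewrite /m; apply/rowP => j; rewrite !mxE; field.
have mz : z - m = - (2^-1 *: (y - z)).
  by rewrite /m; apply/rowP => j; rewrite !mxE; field.
have [[_ _ yz] max1 max2 max3] := ex.
have half : 2^-1 ^+ 2 * sqnorm (y - z) <= e ^+ 2.
  by rewrite exprMn in yz; lra.
have my' : eball m e y by rewrite /eball /= my sqnormZ.
have mz' : eball m e z by rewrite /eball /= mz sqnormN sqnormZ.
have mx : sqnorm (m - x) <= p ^+ 2 / 16.
  have := sqnorm_dist_le m y x; rewrite (sqnormBC m y).
  by rewrite /eball /= in my'; lra.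
have mx4 : sqnorm (m - x) <= p ^+ 2 / 4 by have := sqr_ge0 p; lra.
have [k10 k20 E1 E2] := step _ _ _ ex Myz mx4 my' mz'.
have Km : K m.
  by apply: OK; have [] : [/\ O m, _, _, _ & _] := hp m (inner _ mx4 _ (eball_center _ _)).
have mi : m 0 i + m 0 i = y 0 i + z 0 i by rewrite !mxE; field.
(* The diagonal pair inherits all three clauses: same functional value, same [w]-value and same
   [i]-th coordinate sum. *)
have exm : extremal_pair K w v a e i m m.
  split; rewrite ?E1 ?E2 ?mi //.
  by split => //; rewrite subrr sqnorm0 sqr_ge0.
(* Since [m] lies within [e] of [m'], [step] centred at [m'] makes [(m', m')] a tied pair as well,
   but its coordinate sum is larger by [2 e]. *)
pose m' := m + e *: ebase R i.
have sb : sqnorm (ebase R i) = 1.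
  rewrite /sqnorm /dotv (bigD1 i) //= big1 => [|j /negbTE ji].
    by rewrite !mxE !eqxx mulr1 addr0.
  by rewrite !mxE ji andbF mulr0.
have m'm : sqnorm (m' - m) = e ^+ 2.
  by rewrite /m' addrC addKr sqnormZ sb mulr1.
have m'x : sqnorm (m' - x) <= p ^+ 2 / 4.
  by have := sqnorm_dist_le m' m x; rewrite m'm; have := sqr_ge0 p; lra.
have mm' : eball m' e m by rewrite /eball /= sqnormBC m'm.
have Mm : M0 <= a * w m - v m by rewrite E1.
have [_ _ E3 E4] := step _ _ _ exm Mm m'x mm' mm'.
have Km' : K m'.
  by apply: OK; have [] : [/\ O m', _, _, _ & _] := hp m' (inner _ m'x _ (eball_center _ _)).
have pm' : close_pair K e m' m' by split => //; rewrite subrr sqnorm0 sqr_ge0.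
have [_ _ _ /(_ _ _ pm' E3 E4)] := exm.
by rewrite !mxE !eqxx /=; lra.
Qed.

End Comparison.

(** * Comparison for the scaled subsolution [a w] *)

Section Reduction.
Variables (R : realType) (d : nat).
Local Notation V := 'rV[R]_d.
Implicit Types (K O A : set V) (x y z m q : V) (w v f chi : V -> R).

Lemma usc_on_within A w : usc_on A w -> usc_within A w.
Proof.
move=> uw x Ax e e0; have [r r0 h] := uw x Ax e e0.
by apply/nbhs_ballP; exists r => //= y xy Ay; exact: h.
Qed.

Lemma lsc_on_within A v : lsc_on A v -> usc_within A (fun z => - v z).
Proof.
move=> lv x Ax e e0; have [r r0 h] := lv x Ax e e0.
apply/nbhs_ballP; exists r => //= y xy Ay; have := h y Ay xy; lra.
Qed.

Lemma within_continuous_bounded A chi : compact A -> {within A, continuous chi} ->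
  exists2 C : R, 0 <= C & forall y, A y -> `|chi y| <= C.
Proof.
move=> cA /subspace_continuousP cchi.
have ndist x : A x -> forall e : R, 0 < e ->
    \forall y \near x, A y -> `|chi x - chi y| < e.
  by move=> Ax e e0; have /cvgrPdist_lt /(_ e e0) := cchi x Ax.
have u1 : usc_within A chi.
  move=> x Ax e e0; apply: filterS (ndist x Ax e e0) => y h /h.
  by have := ler_norm (- (chi x - chi y)); rewrite normrN; lra.
have u2 : usc_within A (fun y => - chi y).
  move=> x Ax e e0; apply: filterS (ndist x Ax e e0) => y h /h.
  by have := ler_norm (chi x - chi y); lra.
have [A0|/set0P A0] := eqVneq A set0; first by exists 0 => // y; rewrite A0.
have [p _ hp] := usc_argmax cA A0 u1; have [q _ hq] := usc_argmax cA A0 u2.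
exists (`|chi p| + `|chi q|); first by rewrite addr_ge0.
move=> y Ay; have := hp y Ay; have := hq y Ay.
have := ler_norm (chi p); have := ler_norm (- chi q); rewrite normrN.
have := normr_ge0 (chi p); have := normr_ge0 (chi q).
by rewrite ler_norml => *; apply/andP; split; lra.
Qed.

Lemma compact_closure_bounded O : bounded_set O -> compact (closure O).
Proof.
case=> M [_ hM]; apply: bounded_closed_compact; last exact: closed_closure.
exists (M + 2); split; first exact: num_real.
move=> N MN x clx.
have [y [Oy xy]] := clx _ (nbhsx_ballx x 1 ltr01).
have M1 : M < M + 1 by lra.
have yM : `|y| <= M + 1 := hM _ M1 _ Oy.
move: xy; rewrite -ball_normE /= => xy.
have := ler_normD (x - y) y; rewrite subrK /=; lra.
Qed.

(** The strict boundary inequality keeps the cluster point of extremal pairs off the boundary;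
    continuity of [f] then supplies the local bounds [k1] and [k2] that rule out an interior one. *)
Lemma scaled_comparison O f chi w v (a : R) x : (0 < d)%N -> open O ->
  bounded_set O -> O x -> usc_within (closure O) w ->
  usc_within (closure O) (fun z => - v z) ->
  {in O, continuous chi} -> {in O, continuous f} ->
  visc_sub O f chi w -> visc_super O f chi v -> 0 < a -> a <= 2 ->
  (forall y, bdry O y -> a * w y - v y < a * w x - v x) ->
  (forall y, O y -> (a - 1) * chi y <= (a * w x - v x) / 4) ->
  (forall y, O y -> (a - 1) * f y < 0) \/ (forall y, O y -> f y = 0) ->
  a * w x - v x <= 0.
Proof.
move=> d0 oO bO Ox uw uv cchi cf sub sup a0 a2 hb hchi hf.
rewrite leNgt; apply/negP => M0.
have Kx : closure O x by exact: subset_closure.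
have [xh [clxh Mxh H]] := extremal_pair_cluster (Ordinal d0)
  (compact_closure_bounded bO) Kx uw uv a0 (lexx _).
have Oxh : O xh.
  have [//|nO] := pselect (O xh).
  have /hb : bdry O xh by split => // /interior_subset.
  by rewrite ltNge Mxh.
have [k1 [k2 [nf k12]]] : exists k1 k2, (\forall q \near xh, f q <= k1 /\ - f q <= k2) /\
    (a * k1 + k2 < 0 \/ k1 = 0 /\ k2 = 0).
  case: hf => [hf|hf]; last first.
    exists 0, 0; split; last by right.
    apply: filterS (open_nbhs_nbhs (conj oO Oxh)) => q Oq.
    by rewrite hf // oppr0.
  have := hf _ Oxh => fxh.
  (* With this [e], [a (f xh + e) + (- f xh + e)] equals [(a - 1) f xh / 2], still negative. *)
  pose e := - ((a - 1) * f xh) / (2 * (a + 1)).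
  have a1 : 0 < 2 * (a + 1) by lra.
  have e0 : 0 < e by rewrite divr_gt0 // oppr_gt0.
  have eE : e * (2 * (a + 1)) = - ((a - 1) * f xh) by rewrite divfK // gt_eqF.
  exists (f xh + e), (- f xh + e); split; last by left; lra.
  have /cvgrPdist_lt /(_ _ e0) := cf xh (mem_set Oxh).
  by apply: filterS => q; rewrite ltr_norml => /andP[h1 h2]; split; lra.
exact: (no_interior_cluster oO (@subset_closure _ O) Oxh uw uv cchi sub sup a0 a2
  M0 (hchi _ Oxh) nf k12 H).
Qed.

End Reduction.

Unset Implicit Arguments.

Theorem theorem5p4 (R : realType) (d : nat) (hd : (0 < d)%N)
  (O : set 'rV[R]_d) (f chi g w v : 'rV[R]_d -> R) :
  bounded_domain O -> continuous_boundary O ->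
  {within bdry O, continuous g} ->
  RHS1 O f -> RHS2 O f -> OBS1 O chi g ->
  usc_on (closure O) w -> lsc_on (closure O) v ->
  visc_sub O f chi w -> visc_super O f chi v ->
  (forall x, bdry O x -> w x <= v x) ->
  forall x, O x -> w x <= v x.
Proof.
move=> [_ [ oO [_ bO]]] _ _ [cf _] hf [cchi _] uw lv sub sup wv x Ox.
rewrite leNgt; apply/negP => gap.
have cO := compact_closure_bounded bO.
have [C0 C00 chiC] := within_continuous_bounded cO cchi.
have OK : O `<=` closure O by exact: subset_closure.
have {}cchi : {in O, continuous chi}.
  by rewrite -continuous_open_subspace //; exact: continuous_subspaceW cchi.
have {}cf : {in O, continuous f} by rewrite -continuous_open_subspace.
have {}uw := usc_on_within uw; have {lv}uv := lsc_on_within lv.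
have K0 : closure O !=set0 by exists x; exact: OK.
have [p1 _ wp] := usc_argmax cO K0 uw.
have [p2 _ vp] := usc_argmax cO K0 uv.
(* Bounds [w] and [- v] from above on the closure, and [|w x|] and [|chi|] on the domain, so each
   correction of size [t C] costs at most [m0 / 8]; the summand 1 makes [C] positive. *)
pose C := C0 + `|w p1| + `|v p2| + `|w x| + 1.
have N1 := normr_ge0 (w p1); have N2 := normr_ge0 (v p2).
have N3 := normr_ge0 (w x).
have C_gt0 : 0 < C by rewrite /C; lra.
pose m0 := w x - v x; have m00 : 0 < m0 by rewrite subr_gt0.
pose t := Num.min (1 / 2) (m0 / (8 * C)).
have t0 : 0 < t by rewrite lt_min !divr_gt0 // mulr_gt0.
have t1 : t <= 1 / 2 by rewrite ge_min lexx.
have tC : t * C <= m0 / 8.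
  rewrite -ler_pdivlMr // -mulrA -invfM ge_min lexx orbT //.
have tb (b : R) : b <= C -> t * b <= m0 / 8.
  by move=> bC; apply: le_trans tC; rewrite ler_pM2l.
have wC y : closure O y -> w y <= C.
  by move=> /wp h; apply: (le_trans h); have := ler_norm (w p1); rewrite /C; lra.
have vC y : closure O y -> - v y <= C.
  move=> /vp h; apply: (le_trans h); have := ler_norm (- v p2).
  by rewrite normrN /C; lra.
have wxC : `|w x| <= C by rewrite /C; lra.
have chi_le y : O y -> `|chi y| <= C.
  by move=> /OK/chiC h; apply: (le_trans h); rewrite /C; lra.
case: hf => [[c c0 fc]|[[c c0 fc]|f0]].
(* Here [f < 0] and [a = 1 + t]: at [x] the scaled difference is at least [7 m0 / 8], on the
   boundary at most [m0 / 8]. *)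
- have h1 : t * - w x <= m0 / 8.
    by apply: tb; apply: le_trans wxC; rewrite -normrN ler_norm.
  have : (1 + t) * w x - v x <= 0; last by rewrite /m0 in h1 *; lra.
  apply: (scaled_comparison hd oO bO Ox uw uv cchi cf sub sup) => //.
  + by lra.
  + by lra.
  + move=> y Dy; have := wv y Dy; have := tb _ (wC _ Dy.1).
    by rewrite /m0 in h1 *; lra.
  + move=> y Oy; have := tb _ (le_trans (ler_norm _) (chi_le y Oy)).
    by rewrite /m0 in h1 *; lra.
  + left; move=> y Oy; rewrite addrAC subrr add0r pmulr_rlt0 //.
    exact: le_lt_trans (fc _ Oy) c0.
- have h1 := tb _ (le_trans (ler_norm _) wxC).
  have : (1 - t) * w x - v x <= 0; last by rewrite /m0 in h1 *; lra.
  apply: (scaled_comparison hd oO bO Ox uw uv cchi cf sub sup) => //.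
  + by lra.
  + by lra.
  + move=> y Dy; have := tb _ (vC _ Dy.1).
    (* For [f > 0] and [a = 1 - t], the boundary value splits as [(1 - t) (w y - v y) - t v y],
       which needs only the upper bound on [- v]. *)
    have : (1 - t) * (w y - v y) <= 0.
      by rewrite pmulr_rle0 ?subr_le0 ?wv //; lra.
    by rewrite /m0 in h1 *; lra.
  + move=> y Oy.
    have : t * - chi y <= m0 / 8.
      by apply: tb; apply: le_trans (chi_le y Oy); rewrite -normrN ler_norm.
    by rewrite /m0 in h1 *; lra.
  + left; move=> y Oy; rewrite addrAC subrr add0r nmulr_rlt0 ?oppr_lt0 //.
    exact: lt_le_trans c0 (fc _ Oy).
- have : 1 * w x - v x <= 0; last by rewrite /m0 in m00 *; lra.
  apply: (scaled_comparison hd oO bO Ox uw uv cchi cf sub sup) => //.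
  + by lra.
  + by move=> y Dy; have := wv y Dy; rewrite /m0 in m00; lra.
  + by move=> y Oy; rewrite /m0 in m00; lra.
  + by right.
Qed.
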